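(* Let $m \geq 2$ be an integer and let $d_i(m)$, $0\le i\le m$, be the Boros-Moll coefficients. Then \[ \frac{d_m(m)}{d_0(m)}<\frac{d_{m-1}(m)}{d_1(m)}< \cdots <\frac{d_{m-i}(m)}{d_i(m)}<\frac{d_{m-i-1}(m)}{d_{i+1}(m)}<\cdots <\frac{d_{m-\lfloor\frac{m-1}{2}\rfloor}(m)}{d_{\lfloor\frac{m-1}{2}\rfloor}(m)}<1 \] and \[ \frac{d_0(m)}{d_{m-1}(m)}<\frac{d_1(m)}{d_{m-2}(m)}<\cdots<\frac{d_{i-1}(m)}{d_{m-i}(m)}<\frac{d_i(m)}{d_{m-i-1}(m)}<\cdots<\frac{d_{\lfloor\frac{m}{2}\rfloor-1}(m)}{d_{m-\lfloor\frac{m}{2}\rfloor}(m)}<1. \] That is, the sequence $\{d_i(m)\}_{0\le i\le m}$ is strictly ratio monotone.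
   Context: For a nonnegative integer $m$ and $0\le i\le m$, the Boros-Moll coefficients are \[ d_i(m)=2^{-2m}\sum_{k=i}^m 2^k\binom{2m-2k}{m-k}\binom{m+k}{k}\binom{k}{i}, \] so that $P_m(a)=\sum_{i=0}^m d_i(m)a^i = 2^{-2m}\sum_k 2^k\binom{2m-2k}{m-k}\binom{m+k}{k}(a+1)^k$. A sequence $\{a_i\}_{0\le i\le m}$ of positive numbers is strictly ratio monotone if $\frac{a_0}{a_{m-1}}<\frac{a_1}{a_{m-2}}<\cdots<\frac{a_{\lfloor m/2\rfloor-1}}{a_{m-\lfloor m/2\rfloor}}<1$ and $\frac{a_m}{a_0}<\frac{a_{m-1}}{a_1}<\cdots<\frac{a_{m-\lfloor (m-1)/2\rfloor}}{a_{\lfloor (m-1)/2\rfloor}}<1$. Here $\lfloor x\rfloor$ is the integer part of $x$. *)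

(* Defs.v *)
From mathcomp Require Import all_boot all_order all_algebra.

Set Implicit Arguments.
Unset Strict Implicit.
Unset Printing Implicit Defensive.

Import Order.TTheory GRing.Theory Num.Theory.
Local Open Scope ring_scope.

(* d_i(m); the truncated subtractions are exact since k <= m in the sum. *)
Definition boros_moll (m i : nat) : rat :=
  2 ^- (2 * m)%N *
  \sum_(i <= k < m.+1)
     2 ^+ k * 'C(2 * m - 2 * k, m - k)%:R * 'C(m + k, k)%:R * 'C(k, i)%:R.

(* x 0 < x 1 < ... < x n < 1 *)
Definition strict_chain_lt1 (R : realFieldType) (n : nat) (x : nat -> R) : Prop :=
  (forall i : nat, (i < n)%N -> x i < x i.+1) /\ x n < 1.

(* For a finite sequence a_0, ..., a_m: the values a i with i > m are not used.
   Meaningful for m >= 2, which makes every subtraction below exact (for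
   m < 2 the index m./2 - 1 of the last term of the first chain would be
   negative, and is truncated to 0). *)
Definition strictly_ratio_monotone (R : realFieldType) (m : nat) (a : nat -> R)
    : Prop :=
  [/\ forall i : nat, (i <= m)%N -> 0 < a i,
      strict_chain_lt1 (m./2 - 1) (fun i => a i / a (m - 1 - i)%N)
    & strict_chain_lt1 (m - 1)./2 (fun i => a (m - i)%N / a i)].

(* Main.v *)
Require Import Defs.
From mathcomp Require Import all_boot all_order all_algebra.
From mathcomp Require Import ring lra zify.

(** Write [d i] for [d_i(m)] and [r i = d (i+1) / d i].  Both chains say exactly
    that [r i * r (m-1-i) < 1] and [r i * r (m-2-i) > 1] for all admissible [i].
    These follow from the bounds
      [(m - i - 1/2) / (i + 3/2) < r i < (m - i) / (i + 1)],
    since the upper bounds at [i] and [m-1-i] multiply to [1], and so do the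
    lower bounds at [i] and [m-2-i].  The three-term recurrence in [i] gives
    [r (i-1)] as an increasing function of [r i] and preserves both bounds, so
    they hold by downward induction from [i = m]. *)

Set Implicit Arguments.
Unset Strict Implicit.
Unset Printing Implicit Defensive.

Import Order.TTheory GRing.Theory Num.Theory.
Local Open Scope ring_scope.

Definition boros_moll_coef (m k : nat) : rat :=
  2 ^- (2 * m)%N * (2 ^+ k * 'C(2 * m - 2 * k, m - k)%:R * 'C(m + k, k)%:R).

(** Terms with [k < i] vanish because ['C(k, i) = 0]. A summation range independent of [i] lets sums
    for several indices be combined termwise. *)
Lemma boros_mollE m i :
  boros_moll m i = \sum_(0 <= k < m.+1) boros_moll_coef m k * 'C(k, i)%:R.
Proof.
rewrite /boros_moll mulr_sumr.
under eq_bigr do rewrite mulrA -/(boros_moll_coef _ _).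
have [le_im|lt_mi] := leqP i m.+1.
  rewrite [RHS](big_cat_nat (leq0n i) le_im) /= [X in _ = X + _]big_nat.
  rewrite [X in _ = X + _]big1 ?add0r // => k /andP[_ ltki].
  by rewrite bin_small ?mulr0.
rewrite big_geq 1?ltnW // big_nat big1 // => k /andP[_ ltkm].
by rewrite bin_small ?mulr0 // (leq_trans ltkm) // ltnW.
Qed.

Lemma boros_moll_coef_gt0 m k : (k <= m)%N -> 0 < boros_moll_coef m k.
Proof.
move=> le_km; rewrite /boros_moll_coef !mulr_gt0 ?invr_gt0 ?exprn_gt0 //.
  by rewrite ltr0n bin_gt0; lia.
by rewrite ltr0n bin_gt0; lia.
Qed.

Lemma boros_moll_gt0 m i : (i <= m)%N -> 0 < boros_moll m i.
Proof.
move=> le_im; rewrite boros_mollE big_nat_recr //= ltr_wpDl //.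
  rewrite big_nat sumr_ge0 // => k /andP[_ ltkm].
  by rewrite mulr_ge0 ?ler0n // ltW // boros_moll_coef_gt0 // ltnW.
by rewrite mulr_gt0 ?boros_moll_coef_gt0 // ltr0n bin_gt0.
Qed.

Lemma boros_moll_eq0 m i : (m < i)%N -> boros_moll m i = 0.
Proof. by move=> lt_mi; rewrite /boros_moll big_geq ?mulr0. Qed.

Lemma central_bin_rec n :
  (n.+1 * 'C(2 * n.+1, n.+1) = 2 * (2 * n + 1) * 'C(2 * n, n))%N.
Proof.
have -> : (2 * n.+1 = (2 * n).+2)%N by lia.
have := mul_bin_diag (2 * n).+2 n; have := mul_bin_down (2 * n).+1 n.
have -> : ((2 * n).+1 - n = n.+1)%N by lia.
by rewrite /=; lia.

Qed.

(** In the quotient of consecutive coefficients, the power of 2 contributes 2, the central binomial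
    (m-k) / (2(2(m-k)-1)), and the remaining binomial (m+k+1) / (k+1). *)
Lemma boros_moll_coef_rec m k : (k < m)%N ->
  k.+1%:R * (2 * (m%:R - k%:R) - 1) * boros_moll_coef m k.+1
  = (m%:R - k%:R) * (m%:R + k%:R + 1) * boros_moll_coef m k.
Proof.
move=> lt_km; have [n ->] : exists n, (m = n.+1 + k)%N by exists (m - k.+1)%N; lia.
rewrite /boros_moll_coef.
have -> : (2 * (n.+1 + k) - 2 * k.+1 = 2 * n)%N by lia.
have -> : (n.+1 + k - k.+1 = n)%N by lia.
have -> : (2 * (n.+1 + k) - 2 * k = 2 * n.+1)%N by lia.
have -> : (n.+1 + k - k = n.+1)%N by lia.
have -> : (n.+1 + k + k.+1 = (n.+1 + k + k).+1)%N by lia.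
have hc : n.+1%:R * 'C(2 * n.+1, n.+1)%:R
    = 2 * (2 * n%:R + 1) * 'C(2 * n, n)%:R :> rat.
  by rewrite -natrM central_bin_rec !natrM natrD natrM.
have hb : (n.+1 + k + k).+1%:R * 'C(n.+1 + k + k, k)%:R
    = k.+1%:R * 'C((n.+1 + k + k).+1, k.+1)%:R :> rat.
  by rewrite -!natrM mul_bin_diag.
move: hc hb; set c1 : rat := 'C(2 * n.+1, n.+1)%:R; set c0 : rat := 'C(2 * n, n)%:R.
set b0 : rat := 'C(n.+1 + k + k, k)%:R; set b1 : rat := 'C(_, k.+1)%:R.
move: (2 ^- _) => s; rewrite exprS; move: (2 ^+ k) => t hc hb.
have -> : (n.+1 + k)%:R + k%:R + 1 = (n.+1 + k + k).+1%:R :> rat.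
  by rewrite -natrD natr1.
have -> : (n.+1 + k)%:R - k%:R = n.+1%:R :> rat by rewrite natrD addrK.
transitivity (s * t * (2 * (2 * n%:R + 1) * c0) * (k.+1%:R * b1)).
  by rewrite -[n.+1%:R]natr1; ring.
by rewrite -hc -hb; ring.
Qed.

(* Termwise, the difference of the two sides equals
   [(m-k)(m+k+1) c_k C(k,n) - k (2(m-k)+1) c_k C(k-1,n)], and by the recurrence
   for [c_k] these two families cancel after shifting [k]. *)
Lemma boros_moll_rec m n :
  (m%:R - n%:R) * (m%:R + n%:R + 1) * boros_moll m n
  = n.+1%:R * ((2 * m%:R + 1) * boros_moll m n.+1
               - n.+2%:R * boros_moll m n.+2).
Proof.
pose c := boros_moll_coef m.
pose u k : rat := (m%:R - k%:R) * (m%:R + k%:R + 1) * c k * 'C(k, n)%:R.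
(* At [k = 0] the truncated [k.-1] is harmless, since the factor [k%:R] vanishes. *)
pose v k : rat := k%:R * (2 * (m%:R - k%:R) + 1) * c k * 'C(k.-1, n)%:R.
have uv : \sum_(0 <= k < m.+1) u k = \sum_(0 <= k < m.+1) v k.
  rewrite big_nat_recr //= [RHS]big_nat_recl //=.
  have -> : u m = 0 by rewrite /u subrr !mul0r.
  have -> : v 0%N = 0 by rewrite /v !mul0r.
  rewrite addr0 add0r.
  apply: eq_big_nat => k /andP[_ lt_km].
  rewrite /u /v -boros_moll_coef_rec // -natr1 /c /=.
  by ring.
apply/eqP; rewrite -subr_eq0; apply/eqP.
rewrite -[RHS](subrr (\sum_(0 <= k < m.+1) v k)) -{1}uv.
rewrite !boros_mollE !mulr_sumr -!sumrB mulr_sumr -sumrB.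
apply: eq_bigr => k _; rewrite -/(c k) /u /v.
have kdiff p : p.+1%:R * 'C(k, p.+1)%:R = (k%:R - p%:R) * 'C(k, p)%:R :> rat.
  have [le_pk|lt_kp] := leqP p k; first by rewrite -natrB // -!natrM mul_bin_left.
  by rewrite !bin_small ?mulr0 // ltnW.
have kpred : k%:R * 'C(k.-1, n)%:R = n.+1%:R * 'C(k, n.+1)%:R :> rat.
  by rewrite -!natrM mul_bin_diag.
have h1 := kdiff n; have h2 := kdiff n.+1.
transitivity (c k * ((m%:R - n%:R) * (m%:R + n%:R + 1) * 'C(k, n)%:R
   - (2 * m%:R + 1) * (n.+1%:R * 'C(k, n.+1)%:R)
   + n.+1%:R * (n.+2%:R * 'C(k, n.+2)%:R))); first by ring.
transitivity (c k * ((m%:R - k%:R) * (m%:R + k%:R + 1) * 'C(k, n)%:R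
   - (2 * (m%:R - k%:R) + 1) * (k%:R * 'C(k.-1, n)%:R))); last by ring.
have -> : n.+1%:R * (n.+2%:R * 'C(k, n.+2)%:R)
    = (k%:R - n.+1%:R) * (n.+1%:R * 'C(k, n.+1)%:R) :> rat by rewrite h2; ring.
by rewrite kpred h1 -natr1; ring.
Qed.

(** Inserting the hypothesis into the recurrence gives (m-n)(m+n+1) d_n >= (n+1)(m+n+2) d_{n+1};
    replacing m+n+2 by m+n+1 makes the bound strict. *)
Lemma boros_moll_ratio_lt_step m n : (n < m)%N ->
    n.+2%:R * boros_moll m n.+2 <= (m%:R - n.+1%:R) * boros_moll m n.+1 ->
  n.+1%:R * boros_moll m n.+1 < (m%:R - n%:R) * boros_moll m n.
Proof.
move=> lt_nm IH; have rec := boros_moll_rec m n.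
have d_gt0 := boros_moll_gt0 lt_nm.
have n_ge0 : 0 <= n%:R :> rat by rewrite ler0n.
have m_ge0 : 0 <= m%:R :> rat by rewrite ler0n.
rewrite -(@ltr_pM2l _ (m%:R + n%:R + 1)); last lra.
rewrite [ltRHS]mulrA [_ * (m%:R - _)]mulrC rec mulrCA ltr_pM2l ?ltr0n //.
move: IH; rewrite -[n.+1%:R in X in X -> _]natr1 => IH.
by rewrite -subr_gt0; nra.
Qed.

(** Both sides vanish at [i = m], where the downward induction starts, so it has to carry a weak
    inequality. *)
Lemma boros_moll_ratio_le m i : (i <= m)%N ->
  i.+1%:R * boros_moll m i.+1 <= (m%:R - i%:R) * boros_moll m i.
Proof.
move=> le_im; rewrite -(subKn le_im); move: (m - i)%N (leq_subr i m) => j {i le_im}.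
elim: j => [_|j IHj lt_jm].
  by rewrite subn0 boros_moll_eq0 // subrr mulr0 mul0r.
have := IHj (ltnW lt_jm).
have -> : (m - j = (m - j.+1).+1)%N by lia.
by move=> IH; apply/ltW/boros_moll_ratio_lt_step => //; lia.
Qed.

Lemma boros_moll_ratio_lt m i : (i < m)%N ->
  i.+1%:R * boros_moll m i.+1 < (m%:R - i%:R) * boros_moll m i.
Proof.
by move=> lt_im; apply: boros_moll_ratio_lt_step => //; apply: boros_moll_ratio_le.
Qed.

(** Unlike the upper bound, this one is already strict at [i = m], where it reads -d_m < 0. *)
Lemma boros_moll_ratio_gt m i : (i <= m)%N ->
  (2 * (m%:R - i%:R) - 1) * boros_moll m i < (2 * i%:R + 3) * boros_moll m i.+1.
Proof.
move=> le_im; rewrite -(subKn le_im); move: (m - i)%N (leq_subr i m) => j {i le_im}.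
elim: j => [_|j IHj lt_jm].
  rewrite subn0 (@boros_moll_eq0 m m.+1) // subrr mulr0 mulr0 sub0r mulN1r.
  by rewrite oppr_lt0 boros_moll_gt0.
have := IHj (ltnW lt_jm).
have -> : (m - j = (m - j.+1).+1)%N by lia.
have : (m - j.+1 < m)%N by lia.
move: (m - j.+1)%N => n lt_nm {j IHj lt_jm} IH.
have rec := boros_moll_rec m n.
have d_gt0 := boros_moll_gt0 lt_nm.
have n_ge0 : 0 <= n%:R :> rat by rewrite ler0n.
have lt_nm' : n%:R + 1 <= m%:R :> rat by rewrite natr1 ler_nat.
move: rec IH d_gt0; rewrite -[n.+2%:R]natr1 -[n.+1%:R]natr1.
move: (boros_moll m n) (boros_moll m n.+1) (boros_moll m n.+2) => x y z.
move: (m%:R : rat) (n%:R : rat) n_ge0 lt_nm' => {lt_nm} M N N0 NM rec IH y0.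
have p1 : 0 < (M - N) * (M + N + 1) by rewrite mulr_gt0; lra.
have p2 : 0 < 2 * N + 5 by lra.
(* The first factor turns [x] into the left side of [rec]; the second matches the coefficient of [z]
   in [IH]. *)
rewrite -(ltr_pM2l p1) -(ltr_pM2l p2).
have q : 0 < 2 * (M - N) - 1 by lra.
have bound : (2 * (M - N) - 1) * ((N + 1) * (N + 2)) * ((2 * (M - N) - 3) * y)
    < (2 * (M - N) - 1) * ((N + 1) * (N + 2)) * ((2 * N + 5) * z).
  by rewrite ltr_pM2l ?mulr_gt0 //; lra.
(* After eliminating [x] by [rec] and [z] by [bound], the two sides of the goal
   differ by a positive multiple of this polynomial times [y]. *)
have gap : 0 < 3 * M ^+ 2 + (3 - 4 * (N + 1)) * M
    + 4 * (N + 1) ^+ 3 + 8 * (N + 1) ^+ 2 - (N + 1) by nra.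
have e : (2 * N + 5) * ((M - N) * (M + N + 1) * ((2 * (M - N) - 1) * x))
  = (2 * (M - N) - 1) * ((2 * N + 5) * ((M - N) * (M + N + 1) * x)) by ring.
rewrite e rec.
have gy := mulr_gt0 gap y0.
move: bound gy; lra.
Qed.

Theorem theorem1p1 (m : nat) (hm : (2 <= m)%N) :
  strictly_ratio_monotone m (boros_moll m).
Proof.
have d_gt0 := @boros_moll_gt0 m; set d := boros_moll m in d_gt0 *.
have up i j : (i + j = m.-1)%N -> d i.+1 * d j.+1 < d i * d j.
  move=> eq_ij; have lt_im : (i < m)%N by lia.
  have lt_jm : (j < m)%N by lia.
  have hi := boros_moll_ratio_lt lt_im; have hj := boros_moll_ratio_lt lt_jm.
  rewrite -/d in hi hj.
  have em : m%:R = i%:R + j%:R + 1 :> rat by rewrite -natrD natr1 eq_ij prednK //; lia.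
  have ei : m%:R - i%:R = j.+1%:R :> rat by rewrite em -natr1; ring.
  have ej : m%:R - j%:R = i.+1%:R :> rat by rewrite em -natr1; ring.
  rewrite ei in hi; rewrite ej in hj.
  have c_gt0 : 0 < i.+1%:R * j.+1%:R :> rat by rewrite mulr_gt0 ?ltr0n.
  rewrite -(ltr_pM2l c_gt0) [ltLHS]mulrACA.
  have -> : i.+1%:R * j.+1%:R * (d i * d j) = j.+1%:R * d i * (i.+1%:R * d j) by ring.
  by apply: ltr_pM => //; rewrite mulr_ge0 // ltW // d_gt0.
have low i j : (i + j = m - 2)%N -> d i * d j < d i.+1 * d j.+1.
  move=> eq_ij; have le_im : (i <= m)%N by lia.
  have le_jm : (j <= m)%N by lia.
  have hi := boros_moll_ratio_gt le_im; have hj := boros_moll_ratio_gt le_jm.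
  rewrite -/d in hi hj.
  have em : m%:R = i%:R + j%:R + 2 :> rat by rewrite -!natrD eq_ij subnK.
  have ei : 2 * (m%:R - i%:R) - 1 = 2 * j%:R + 3 :> rat by rewrite em; ring.
  have ej : 2 * (m%:R - j%:R) - 1 = 2 * i%:R + 3 :> rat by rewrite em; ring.
  rewrite ei in hi; rewrite ej in hj.
  have ci : 0 < 2 * i%:R + 3 :> rat by have := ler0n rat i; lra.
  have cj : 0 < 2 * j%:R + 3 :> rat by have := ler0n rat j; lra.
  rewrite -(ltr_pM2l (mulr_gt0 ci cj)) [ltRHS]mulrACA.
  set a := 2 * i%:R + 3 in hi hj ci *; set b := 2 * j%:R + 3 in hi hj cj *.
  have -> : a * b * (d i * d j) = b * d i * (a * d j) by ring.
  by apply: ltr_pM => //; rewrite mulr_ge0 ?(ltW ci) ?(ltW cj) // ltW // d_gt0.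
(* The last term of each chain is below [1] by [low] or [up] at [(n, n)] or
   [(n, n+1)], according to the parity of [m]. *)
have sq_lt x y : 0 < x -> 0 < y -> x * x < y * y -> x < y :> rat by nra.
split=> //; split.
- move=> i lt_i.
  (* With j = m-2-i, cross-multiplying d_i / d_{j+1} < d_{i+1} / d_j gives [low i j]. *)
  have [j ej] : exists j, (m - 1 - i = j.+1)%N by exists (m - 2 - i)%N; lia.
  have -> : (m - 1 - i.+1 = j)%N by lia.
  rewrite ej ltr_pdivrMr ?d_gt0 //; last lia.
  rewrite mulrAC ltr_pdivlMr ?d_gt0 //; last lia.
  by apply: low; lia.
- rewrite ltr_pdivrMr ?mul1r ?d_gt0 //; last lia.
  set n := (m./2 - 1)%N; have [odd_m|even_m] := boolP (odd m).
    have -> : (m - 1 - n = n.+2)%N by rewrite /n; lia.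
    (* The common factor d_{n+1} cancels, leaving d_n < d_{n+2}. *)
    have := low n n.+1; rewrite [d n * _]mulrC ltr_pM2l ?d_gt0 //; last lia.
    by apply; lia.
  have -> : (m - 1 - n = n.+1)%N by rewrite /n; lia.
  by apply: sq_lt; [apply: d_gt0|apply: d_gt0|apply: low]; lia.
- move=> i lt_i.
  (* With j = m-1-i, the link d_{j+1} / d_i < d_j / d_{i+1} becomes [up i j]. *)
  have [j ej] : exists j, (m - i = j.+1)%N by exists (m - 1 - i)%N; lia.
  have -> : (m - i.+1 = j)%N by lia.
  rewrite ej ltr_pdivrMr ?d_gt0 //; last lia.
  rewrite mulrAC ltr_pdivlMr ?d_gt0 //; last lia.
  by rewrite mulrC [ltRHS]mulrC; apply: up; lia.
- rewrite ltr_pdivrMr ?mul1r ?d_gt0 //; last lia.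
  set n := (m - 1)./2; have [odd_m|even_m] := boolP (odd m).
    have -> : (m - n = n.+1)%N by rewrite /n; lia.
    by apply: sq_lt; [apply: d_gt0|apply: d_gt0|apply: up]; lia.
  have -> : (m - n = n.+2)%N by rewrite /n; lia.
  have := up n n.+1; rewrite [d n * _]mulrC ltr_pM2l ?d_gt0 //; last lia.
  by apply; lia.
Qed.
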